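(* There is an absolute constant $C$ such that the following holds. Let $\mathcal{P}$ be a set of $n$ points in the double plane $\mathbb{S}^2$, let $d\in\mathbb{S}$ be a non-zero distance, and let $0\le\lambda\le 1$. Let $N_d(\mathcal{P})$ be the number of times $d$ is spanned by $\mathcal{P}$, that is, the number of pairs of points $p,q\in\mathcal{P}$ with $\rho_{\mathbb{S}^2}(p,q)=d$. (a) If $d$ is of type A and $\mathcal{P}$ has minimal multiplicity $n^{\lambda}$, then \[ N_d(\mathcal{P})\le C\left(n^{4/3+\lambda/3}+n^{1+\lambda}\right)\log^2 n. \] (b) If $d$ is of type B and $\mathcal{P}$ has real multiplicity $n^{\lambda}$, then $N_d(\mathcal{P})\le C\,n^{1+\lambda/3}$. (c) If $d$ is of type C and $\mathcal{P}$ has imaginary multiplicity $n^{\lambda}$, then $N_d(\mathcal{P})\le C\,n^{1+\lambda/3}$.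
   Context: The double numbers $\mathbb{S}$ are the two-dimensional unital associative $\mathbb{R}$-algebra obtained by adjoining to $\mathbb{R}$ an element $j$ with $j^2=1$. Each double number is uniquely $X+Yj$ with $X,Y\in\mathbb{R}$; it is denoted $\langle x,y\rangle$ where $x=X+Y$ and $y=X-Y$. A point $(X+Yj,Z+Wj)\in\mathbb{S}^2$ is denoted $\langle x,y,z,w\rangle$ where $x=X+Y$, $y=X-Y$, $z=Z+W$, $w=Z-W$. Its real part is $(x,z)\in\mathbb{R}^2$ and its imaginary part is $(y,w)\in\mathbb{R}^2$. The distance function $\rho_{\mathbb{S}^2}:\mathbb{S}^2\times\mathbb{S}^2\to\mathbb{S}$ is $\rho_{\mathbb{S}^2}((a,b),(a',b'))=(a-a')^2+(b-b')^2$ (arithmetic in $\mathbb{S}$). In the new coordinates, \[\rho_{\mathbb{S}^2}(\langle x,y,z,w\rangle,\langle x',y',z',w'\rangle)=\langle (x-x')^2+(z-z')^2,\ (y-y')^2+(w-w')^2\rangle .\] Distances are elements $d=\langle d_1,d_2\rangle$ with $d_1,d_2\ge 0$. A non-zero distance is of type A if $d_1>0$ and $d_2>0$; of type B if $d_1=0$ and $d_2>0$; of type C if $d_1>0$ and $d_2=0$. For a finite nonempty set $\mathcal{P}\subset\mathbb{S}^2$, the real multiplicity is the largest integer $k$ such that $k$ points of $\mathcal{P}$ have the same real part; the imaginary multiplicity is the largest integer $k$ such that $k$ points of $\mathcal{P}$ have the same imaginary part; the minimal multiplicity is the minimum of the real and imaginary multiplicities. *)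

(* Defs.v *)
From HB Require Import structures.
From mathcomp Require Import all_boot all_order all_algebra finmap.
From mathcomp Require Import reals exp.
From mathcomp Require Import ring.

Set Implicit Arguments.
Unset Strict Implicit.
Unset Printing Implicit Defensive.

Import Order.TTheory GRing.Theory Num.Theory.

Local Open Scope ring_scope.

(* [DoubleNumber X Y] is X + Y j, with j ^+ 2 = 1. *)
Record double_number (R : Type) : Type := DoubleNumber { dn1 : R; dnj : R }.

Section DoubleNumberTypes.

Definition pair_of_double (R : Type) (a : double_number R) : R * R :=
  (dn1 a, dnj a).
Definition double_of_pair (R : Type) (u : R * R) : double_number R :=
  DoubleNumber u.1 u.2.

Lemma pair_of_doubleK (R : Type) :
  cancel (@pair_of_double R) (@double_of_pair R).
Proof. by case. Qed.

HB.instance Definition _ (R : choiceType) :=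
  Choice.copy (double_number R) (can_type (@pair_of_doubleK R)).

End DoubleNumberTypes.

Section DoubleNumberAlgebra.
Variable R : comNzRingType.
Local Notation S := (double_number R).
Implicit Types (a b c : S) (k : R).

Definition dn_zero : S := DoubleNumber 0 0.
Definition dn_one : S := DoubleNumber 1 0.
Definition dn_opp a : S := DoubleNumber (- dn1 a) (- dnj a).
Definition dn_add a b : S := DoubleNumber (dn1 a + dn1 b) (dnj a + dnj b).
Definition dn_mul a b : S :=
  DoubleNumber (dn1 a * dn1 b + dnj a * dnj b) (dn1 a * dnj b + dnj a * dn1 b).
Definition dn_scale k a : S := DoubleNumber (k * dn1 a) (k * dnj a).

Fact dn_addA : associative dn_add.
Proof. by move=> a b c; congr DoubleNumber => /=; ring. Qed.
Fact dn_addC : commutative dn_add.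
Proof. by move=> a b; congr DoubleNumber => /=; ring. Qed.
Fact dn_add0 : left_id dn_zero dn_add.
Proof. by case=> X Y; congr DoubleNumber => /=; ring. Qed.
Fact dn_addN : left_inverse dn_zero dn_opp dn_add.
Proof. by case=> X Y; congr DoubleNumber => /=; ring. Qed.

HB.instance Definition _ :=
  GRing.isZmodule.Build S dn_addA dn_addC dn_add0 dn_addN.

Fact dn_mulA : associative dn_mul.
Proof. by move=> a b c; congr DoubleNumber => /=; ring. Qed.
Fact dn_mulC : commutative dn_mul.
Proof. by move=> a b; congr DoubleNumber => /=; ring. Qed.
Fact dn_mul1 : left_id dn_one dn_mul.
Proof. by case=> X Y; congr DoubleNumber => /=; ring. Qed.
Fact dn_mulDl : left_distributive dn_mul +%R.
Proof. by move=> a b c; congr DoubleNumber => /=; ring. Qed.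
Fact dn_oner_neq0 : dn_one != 0.
Proof. by apply/eqP => -[] /eqP; rewrite oner_eq0. Qed.

HB.instance Definition _ := GRing.Zmodule_isComNzRing.Build S
  dn_mulA dn_mulC dn_mul1 dn_mulDl dn_oner_neq0.

Fact dn_scaleA k l a : dn_scale k (dn_scale l a) = dn_scale (k * l) a.
Proof. by congr DoubleNumber => /=; ring. Qed.
Fact dn_scale1 : left_id 1 dn_scale.
Proof. by case=> X Y; congr DoubleNumber => /=; ring. Qed.
Fact dn_scaleDr : right_distributive dn_scale +%R.
Proof. by move=> k a b; congr DoubleNumber => /=; ring. Qed.
Fact dn_scaleDl a : {morph dn_scale^~ a : k l / k + l}.
Proof. by move=> k l; congr DoubleNumber => /=; ring. Qed.

HB.instance Definition _ := GRing.Zmodule_isLmodule.Build R S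
  dn_scaleA dn_scale1 dn_scaleDr dn_scaleDl.

Fact dn_scaleAl k a b : k *: (a * b) = k *: a * b.
Proof. by congr DoubleNumber => /=; ring. Qed.

HB.instance Definition _ := GRing.Lmodule_isLalgebra.Build R S dn_scaleAl.
HB.instance Definition _ := GRing.Lalgebra_isComAlgebra.Build R S.

Definition dn_unitj : S := DoubleNumber 0 1.

Lemma dn_unitj_sqr : dn_unitj ^+ 2 = 1.
Proof. by rewrite expr2; congr DoubleNumber => /=; ring. Qed.

Lemma double_numberE a : a = (dn1 a)%:A + dnj a *: dn_unitj.
Proof. by case: a => X Y; congr DoubleNumber => /=; ring. Qed.

(* X + Y j is denoted <x, y> with x = X + Y and y = X - Y. *)
Definition dnx a : R := dn1 a + dnj a.
Definition dny a : R := dn1 a - dnj a.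

Definition real_part (p : S * S) : R * R := (dnx p.1, dnx p.2).
Definition imag_part (p : S * S) : R * R := (dny p.1, dny p.2).

Definition rho (p q : S * S) : S := (p.1 - q.1) ^+ 2 + (p.2 - q.2) ^+ 2.

Lemma dnx_rho p q :
  dnx (rho p q) = (dnx p.1 - dnx q.1) ^+ 2 + (dnx p.2 - dnx q.2) ^+ 2.
Proof. by rewrite /rho !expr2 /dnx /=; ring. Qed.

Lemma dny_rho p q :
  dny (rho p q) = (dny p.1 - dny q.1) ^+ 2 + (dny p.2 - dny q.2) ^+ 2.
Proof. by rewrite /rho !expr2 /dny /=; ring. Qed.

End DoubleNumberAlgebra.

Local Open Scope fset_scope.

(* The largest number of points of P on which f takes a common value
   (0 when P is empty). *)
Definition multiplicity (K : choiceType) (T : eqType) (f : K -> T)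
    (P : {fset K}) : nat :=
  \max_(p <- P) #|` [fset q in P | f q == f p]|.

Lemma multiplicityP (K : choiceType) (T : eqType) (f : K -> T)
    (P : {fset K}) (k : nat) :
  reflect (exists A : {fset K}, [/\ A `<=` P, #|` A| = k &
             {in A &, forall p q, f p = f q}])
          (k <= multiplicity f P)%N.
Proof.
apply: (iffP idP) => [|[A [sAP <- fA]]]; last first.
  have [->|[p pA]] := fset_0Vmem A; first by rewrite cardfs0.
  have pP := fsubsetP sAP p pA.
  apply: leq_trans (leq_bigmax_seq _ pP isT).
  apply: fsubset_leq_card; apply/fsubsetP => q qA.
  by rewrite !inE /= (fsubsetP sAP q qA) (fA q p) /=.
have sub (B : {fset K}) : (k <= #|` B|)%N ->
    exists2 A : {fset K}, A `<=` B & #|` A| = k.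
  move=> lekB; exists [fset x in take k (enum_fset B)].
    by apply/fsubsetP => x; rewrite !inE => /mem_take.
  rewrite card_fseq undup_id; last exact/take_uniq/fset_uniq.
  by rewrite size_takel.
case: k sub => [|k] sub lek.
  by exists fset0; rewrite fsub0set cardfs0.
have [p pP lekp] : exists2 p, p \in P &
    (k < #|` [fset q in P | f q == f p]|)%N.
  apply/hasP; apply: contraTT lek => /hasPn noP; rewrite -ltnNge ltnS.
  by apply/bigmax_leqP_seq => p pP _; rewrite leqNgt; exact: noP.
have [A sA cA] := sub _ lekp.
exists A; split=> //.
  by apply: (fsubset_trans sA); apply/fsubsetP => q; rewrite !inE => /andP[].
move=> q r /(fsubsetP sA) + /(fsubsetP sA).
by rewrite !inE /= => /andP[_ /eqP->] /andP[_ /eqP->].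
Qed.

Section DoublePlane.
Variable R : realType.
Local Notation S := (double_number R).
Implicit Types (P : {fset S * S}) (d : S).

Definition real_multiplicity P : nat := multiplicity (@real_part R) P.
Definition imag_multiplicity P : nat := multiplicity (@imag_part R) P.
Definition min_multiplicity P : nat :=
  minn (real_multiplicity P) (imag_multiplicity P).

Definition is_distance d : bool := (0 <= dnx d) && (0 <= dny d).
Definition typeA d : bool := (0 < dnx d) && (0 < dny d).
Definition typeB d : bool := (dnx d == 0) && (0 < dny d).
Definition typeC d : bool := (0 < dnx d) && (dny d == 0).

(* Ordered pairs; counting unordered pairs instead only halves the value for
   d != 0. *)
Definition nb_spanned d P : nat :=
  #|` [fset u in P `*` P | rho u.1 u.2 == d]|.

End DoublePlane.

(* Main.v *)
(* The real and imaginary parts of a pair at distance d are pairs of points of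
   the real plane at distances sqrt d1 and sqrt d2, so everything rests on the
   Spencer-Szemeredi-Trotter bound on repeated distances in R^2. This is
   Szekely's argument: the upper semicircles of a fixed radius are translates of
   a strictly concave graph, hence two of them meet at most once; join
   consecutive points on each of them by an arc. A family of n vertices without
   crossing arcs has at most 3n arcs, and sampling the vertices independently
   with probability p turns this into the crossing inequality
   E <= 3n/p + p^2 m^2 for m semicircles.
   For types B and C, sum the planar bound over the classes of points with equal
   real (resp. imaginary) part. For type A, take the classes of the part that
   attains the minimal multiplicity and split them dyadically by size; for each
   of the O(log^2 n) pairs of sizes, multiply the number of pairs of classes at
   the first distance by the number of pairs of points at the second distance
   inside one pair of classes, both estimated by the planar bound. *)
Require Import Defs.
From mathcomp Require Import all_boot all_order all_algebra finmap.
From mathcomp Require Import boolp reals exp.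
From mathcomp Require Import ring lra zify.

Set Implicit Arguments.
Unset Strict Implicit.
Unset Printing Implicit Defensive.

Import Order.TTheory GRing.Theory Num.Theory.
Local Open Scope ring_scope.

(** * Independent sampling of a finite set *)

Section Sampling.
Variables (R : comPzRingType) (I : finType) (p : R).

Definition sample_weight (V : {set I}) : R := \prod_i (if i \in V then p else 1 - p).

(** The events that contain [S] have total probability [p ^+ #|S|]. This is one product expanded by
    distributivity, with the second summand set to 0 on [S] so that every [V] missing a point of [S]
    vanishes. *)
Lemma sum_sample_weight (S : {set I}) :
  \sum_(V : {set I} | S \subset V) sample_weight V = p ^+ #|S|.
Proof.
transitivity (\prod_i (p + (if i \in S then 0 else 1 - p))); last first.
  rewrite -prodr_const [LHS](bigID (mem S)) /= [X in _ * X]big1 ?mulr1.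
    by apply: eq_bigr => i ->; rewrite addr0.
  by move=> i /negbTE->; rewrite addrC subrK.
rewrite bigA_distr /= big_mkcond /=; apply: eq_bigr => V _.
case: ifP => [/subsetP sSV|/negbT/subsetPn[i iS /negbTE iV]].
  apply: eq_bigr => i _; case: ifP => // /negbT iV.
  by rewrite (negbTE (contra (sSV i) iV)).
by rewrite (bigD1 i) //= iV iS mul0r.
Qed.

Lemma sum_sample_card (K : finType) (A : {set K}) (S : K -> {set I}) :
  \sum_(V : {set I}) sample_weight V * #|[set a in A | S a \subset V]|%:R =
  \sum_(a in A) p ^+ #|S a|.
Proof.
under eq_bigr => V _ do rewrite -sum1_card natr_sum mulr_sumr.
under [RHS]eq_bigr => a _ do rewrite -sum_sample_weight.
rewrite (exchange_big_dep (mem A)) /=; last by move=> V a _; rewrite inE => /andP[].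
apply: eq_bigr => a aA; apply: eq_big => [V|V _]; last by rewrite mulr1.
by rewrite inE aA.
Qed.

End Sampling.

(** * Arcs on a family of graphs that pairwise meet at most once *)

Section PseudoSegments.
Variables (R : realFieldType) (I J : finType) (x y : I -> R).
Variables (dom : J -> pred R) (g : J -> R -> R).

Hypothesis xy_inj : forall u v, x u = x v -> y u = y v -> u = v.
Hypothesis dom_convex : forall j s m t,
  dom j s -> dom j t -> s <= m -> m <= t -> dom j m.
(** Used in both orders of [j] and [k], this says that two distinct graphs change order at most once
    on their common domain. *)
Hypothesis g_between : forall j k s m t, j != k ->
  dom j s -> dom k s -> dom j t -> dom k t -> s < m -> m < t ->
  g j s <= g k s -> g j t <= g k t -> g j m < g k m.

Definition on j u := dom j (x u) && (y u == g j (x u)).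

Local Notation arc := (J * (I * I))%type.
Implicit Types (e : arc) (F : {set arc}).

Definition is_arc e := [&& on e.1 e.2.1, on e.1 e.2.2, x e.2.1 < x e.2.2 &
  [forall w, on e.1 w ==> ~~ (x e.2.1 < x w < x e.2.2)]].

Definition over e s := x e.2.1 <= s <= x e.2.2.

(** A crossing is a reversal of strict order rather than a common point. It is oriented: [e] starts
    below [e'] and ends above it. *)
Definition crossing e e' := `[< exists s t, [/\ s < t, over e s && over e t,
  over e' s && over e' t, g e.1 s < g e'.1 s & g e'.1 t < g e.1 t] >].

Lemma dom_over e s : is_arc e -> over e s -> dom e.1 s.
Proof.
case/and4P=> /andP[d1 _] /andP[d2 _] _ _ /andP[h1 h2].
exact: dom_convex d1 d2 h1 h2.
Qed.

Lemma over_left e : is_arc e -> over e (x e.2.1).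
Proof. by case/and4P=> _ _ h _; rewrite /over lexx ltW. Qed.

Lemma over_right e : is_arc e -> over e (x e.2.2).
Proof. by case/and4P=> _ _ h _; rewrite /over lexx ltW. Qed.

Lemma over_lt e s : x e.2.1 < s < x e.2.2 -> over e s.
Proof. by rewrite /over => /andP[/ltW-> /ltW->]. Qed.

Lemma y_left e : is_arc e -> y e.2.1 = g e.1 (x e.2.1).
Proof. by case/and4P=> /andP[_ /eqP]. Qed.

Lemma y_right e : is_arc e -> y e.2.2 = g e.1 (x e.2.2).
Proof. by case/and4P=> _ /andP[_ /eqP]. Qed.

Lemma x_arc e : is_arc e -> x e.2.1 < x e.2.2.
Proof. by case/and4P. Qed.

Lemma interior_off_arc e w : is_arc e -> x e.2.1 < x w < x e.2.2 ->
  y w != g e.1 (x w).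
Proof.
move=> ae xw; apply: contraL (xw) => yw.
case/and4P: (ae) => _ _ _ /forallP/(_ w)/implyP; apply.
by rewrite /on yw (dom_over ae (over_lt xw)).
Qed.

(** If corresponding ends had different abscissas, one of them would lie strictly inside the other
    arc, which joins consecutive points. *)
Lemma arc_overlap_eq e e' : is_arc e -> is_arc e' -> e.1 = e'.1 ->
  x e.2.1 < x e'.2.2 -> x e'.2.1 < x e.2.2 -> e = e'.
Proof.
case: e => [j [u v]]; case: e' => [k [u' v']] /= ae ae' ejk; subst k.
move=> h1 h2.
have [] : u = u' /\ v = v'; last by move=> -> ->.
have := @interior_off_arc _ u' ae; have := @interior_off_arc _ u ae'.
have := @interior_off_arc _ v' ae; have := @interior_off_arc _ v ae'.
have /= := (y_left ae, y_right ae, y_left ae', y_right ae') => -[[[-> ->] ->] ->].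

rewrite /= !eqxx h1 h2 /= ?andbT => A B C D.
have eu : x u = x u'.
  by case: (ltgtP (x u) (x u')) => // lt; [move: D | move: C]; rewrite lt => /(_ isT).
have ev : x v = x v'.
  by case: (ltgtP (x v) (x v')) => // lt; [move: A | move: B]; rewrite lt => /(_ isT).
split; apply: xy_inj => //.
  by have /= := (y_left ae, y_left ae') => -[-> ->]; rewrite eu.
by have /= := (y_right ae, y_right ae') => -[-> ->]; rewrite ev.
Qed.

(** At the midpoint, [g_between] in both directions gives opposite strict inequalities. *)
Lemma meet_once j k s t : j != k -> dom j s -> dom k s -> dom j t -> dom k t ->
  s < t -> g j s = g k s -> g j t = g k t -> False.
Proof.
move=> jk js ks jt kt st es et.
have h1 : s < (s + t) / 2 by lra.
have h2 : (s + t) / 2 < t by lra.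
have kj : k != j by rewrite eq_sym.
have lt1 : g j ((s + t) / 2) < g k ((s + t) / 2).
  by apply: (g_between jk js ks jt kt) => //; rewrite ?es ?et.
have := @g_between k j s _ t kj ks js kt jt h1 h2.
by rewrite es et !lexx => /(_ isT isT) /lt_trans/(_ lt1); rewrite ltxx.
Qed.

(** With equality at [a], [g_between] passes the order at the farther of [s] and [t] to the nearer
    one, so a reversal is impossible. *)
Lemma order_after j k a s t : dom j a -> dom k a -> dom j s -> dom k s ->
  dom j t -> dom k t -> g j a = g k a -> a < s -> a < t ->
  g j s < g k s -> g j t < g k t.
Proof.
move=> ja ka js ks jt kt ea ls lt hs.
have jk : j != k by apply: contraTneq hs => ->; rewrite ltxx.
have kj : k != j by rewrite eq_sym.
have [st|ts|<- //] := ltgtP s t; last first.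
  by apply: (@g_between j k a t s) => //; rewrite ?ea // ltW.
rewrite ltNge; apply/negP => ht.
have := @g_between k j a s t kj ka ja kt jt ls st.
by rewrite ea lexx ht => /(_ isT isT) /lt_trans/(_ hs); rewrite ltxx.
Qed.

Lemma order_before j k a s t : dom j a -> dom k a -> dom j s -> dom k s ->
  dom j t -> dom k t -> g j a = g k a -> s < a -> t < a ->
  g j s < g k s -> g j t < g k t.
Proof.
move=> ja ka js ks jt kt ea ls lt hs.
have jk : j != k by apply: contraTneq hs => ->; rewrite ltxx.
have kj : k != j by rewrite eq_sym.
have [st|ts|<- //] := ltgtP s t.
  by apply: (@g_between j k s t a) => //; rewrite ?ea // ltW.
rewrite ltNge; apply/negP => ht.
have := @g_between k j t s a kj kt jt ka ja ts ls.
by rewrite ea lexx ht => /(_ isT isT) /lt_trans/(_ hs); rewrite ltxx.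
Qed.

(** Two graphs reverse their order only once, so the intervals of the two reversals overlap. Arcs of
    the same graph over overlapping intervals coincide. *)
Lemma crossing_unique e1 e1' e2 e2' :
  is_arc e1 -> is_arc e1' -> is_arc e2 -> is_arc e2' ->
  crossing e1 e1' -> crossing e2 e2' -> e1.1 = e2.1 -> e1'.1 = e2'.1 ->
  (e1, e1') = (e2, e2').
Proof.
move=> a1 a1' a2 a2' /asboolP[s1 [t1 [st1 /andP[os1 ot1] /andP[os1' ot1'] ls1 lt1]]].
move=> /asboolP[s2 [t2 [st2 /andP[os2 ot2] /andP[os2' ot2'] ls2 lt2]]] E E'.
have D := (dom_over a1 os1, dom_over a1 ot1, dom_over a1' os1', dom_over a1' ot1',
  dom_over a2 os2, dom_over a2 ot2, dom_over a2' os2', dom_over a2' ot2').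
rewrite -?E -?E' in D ls2 lt2.
case: D => [[[[[[[D1 D2] D3] D4] D5] D6] D7] D8].
have jk : e1.1 != e1'.1 by apply: contraTneq ls1 => ->; rewrite ltxx.
have {}st1' : t1 <= s2 -> False.
  rewrite le_eqVlt => /predU1P[e|lt].
    by subst; have := lt_trans ls2 lt1; rewrite ltxx.
  have := @g_between _ _ s1 t1 s2 jk D1 D3 D5 D7 st1 lt (ltW ls1) (ltW ls2).
  by move=> /lt_trans/(_ lt1); rewrite ltxx.
have {}st2' : t2 <= s1 -> False.
  rewrite le_eqVlt => /predU1P[e|lt].
    by subst; have := lt_trans ls1 lt2; rewrite ltxx.
  have := @g_between _ _ s2 t2 s1 jk D5 D7 D1 D3 st2 lt (ltW ls2) (ltW ls1).
  by move=> /lt_trans/(_ lt2); rewrite ltxx.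
have h1 : s2 < t1 by rewrite ltNge; apply/negP.
have h2 : s1 < t2 by rewrite ltNge; apply/negP.
move: os1 ot1 os1' ot1' os2 ot2 os2' ot2'; rewrite /over.
do 8![case/andP=> ? ?].
by congr (_, _); apply: arc_overlap_eq => //; lra.
Qed.

(** A common left or right end would freeze the order by [order_after] or [order_before]. Four
    distinct ends are what gives a crossing probability [p ^+ 4]. *)
Lemma crossing_disjoint e e' : is_arc e -> is_arc e' -> crossing e e' ->
  uniq [:: e.2.1; e.2.2; e'.2.1; e'.2.2].
Proof.
move=> ae ae' /asboolP[s [t [st /andP[os ot] /andP[os' ot'] ls lt]]].
have jk : e.1 != e'.1 by apply: contraTneq ls => ->; rewrite ltxx.
have kj : e'.1 != e.1 by rewrite eq_sym.
have neq (u v : I) : (x u = x v -> y u = y v -> False) -> u != v.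
  by move=> h; apply/eqP => E; apply: h; rewrite E.
have [ds ds'] := (dom_over ae os, dom_over ae' os').
have [dt dt'] := (dom_over ae ot, dom_over ae' ot').
have [xe xe'] := (x_arc ae, x_arc ae').
have [dl dr] := (dom_over ae (over_left ae), dom_over ae (over_right ae)).
have [dl' dr'] := (dom_over ae' (over_left ae'), dom_over ae' (over_right ae')).
move: os ot os' ot'; rewrite /over; do 4![case/andP=> ? ?].
have n1 : e.2.1 != e.2.2 by apply: neq => E; move: xe; rewrite E ltxx.
have n2 : e'.2.1 != e'.2.2 by apply: neq => E; move: xe'; rewrite E ltxx.
have n3 : e.2.1 != e'.2.2 by apply: neq => E _; lra.
have n4 : e.2.2 != e'.2.1 by apply: neq => E _; lra.
have n5 : e.2.1 != e'.2.1.
  apply: neq => Ex; rewrite (y_left ae) (y_left ae') -Ex => Ey.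
  rewrite -Ex in dl'.
  have ls1 : x e.2.1 < s.
    rewrite lt_neqAle; apply/andP; split=> //; apply: contraTneq ls => <-.
    by rewrite Ey ltxx.
  have := @order_after e.1 e'.1 _ s t dl dl' ds ds' dt dt' Ey ls1 (lt_trans ls1 st) ls.
  by move=> /lt_trans/(_ lt); rewrite ltxx.
have n6 : e.2.2 != e'.2.2.
  apply: neq => Ex; rewrite (y_right ae) (y_right ae') -Ex => Ey.
  rewrite -Ex in dr'.
  have ls1 : t < x e.2.2.
    rewrite lt_neqAle; apply/andP; split=> //; apply: contraTneq lt => ->.
    by rewrite Ey ltxx.
  have := @order_before e.1 e'.1 _ s t dr dr' ds ds' dt dt' Ey (lt_trans st ls1) ls1 ls.
  by move=> /lt_trans/(_ lt); rewrite ltxx.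
by rewrite /= !inE !negb_or n1 n2 n3 n4 n5 n6.
Qed.

(** * Linear bound for families without crossing arcs *)

Section NonCrossing.
Variables (F : {set arc}) (V : {set I}).
Hypothesis F_arc : forall e, e \in F -> is_arc e.
Hypothesis F_vertices : forall e, e \in F -> (e.2.1 \in V) && (e.2.2 \in V).
Hypothesis F_noncrossing :
  forall e e', e \in F -> e' \in F -> ~~ crossing e e'.

Lemma noncrossing_le e e' s t : e \in F -> e' \in F -> s < t ->
  over e s -> over e t -> over e' s -> over e' t ->
  g e.1 s < g e'.1 s -> g e.1 t <= g e'.1 t.
Proof.
move=> eF eF' st os ot os' ot' ls; rewrite leNgt.
apply: contra (F_noncrossing eF eF') => lt.
by apply/asboolP; exists s, t; split => //; apply/andP.
Qed.

Lemma noncrossing_le_left e e' s t : e \in F -> e' \in F -> s < t ->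
  over e s -> over e t -> over e' s -> over e' t ->
  g e.1 t < g e'.1 t -> g e.1 s <= g e'.1 s.
Proof.
move=> eF eF' st os ot os' ot' lt; rewrite leNgt; apply/negP => ls.
by have := noncrossing_le eF' eF st os' ot' os ot ls; rewrite leNgt lt.
Qed.

Definition above_at_left e e' := [&& e' \in F, e'.2.1 == e.2.1 &
  `[< exists s, [/\ over e s, over e' s & g e.1 s < g e'.1 s] >]].

Definition above_at_right e e' := [&& e' \in F, e'.2.2 == e.2.2 &
  `[< exists s, [/\ over e s, over e' s & g e.1 s < g e'.1 s] >]].

(** The arc [e] is the first one of [F] met when going down from [w]; ties are excluded later, by
    [sees_inj]. *)
Definition sees e w := (x e.2.1 < x w < x e.2.2) && (g e.1 (x w) < y w) &&
  [forall e' in F, (x e'.2.1 < x w < x e'.2.2) && (g e'.1 (x w) < y w)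
    ==> (g e'.1 (x w) <= g e.1 (x w))].

(** Two such arcs with a common left end lie on different graphs. At the smaller right end
    [meet_once] forbids equality, so one arc is below the other and is not top. *)
Lemma top_left_inj : {in [set e in F | ~~ [exists e', above_at_left e e']] &,
  injective (fun e : arc => e.2.1)}.
Proof.
move=> e1 e2; rewrite !inE => /andP[eF1 top1] /andP[eF2 top2] e12.
have [a1 a2] := (F_arc eF1, F_arc eF2).
apply/eqP; apply/negPn/negP => ne.
have jk : e1.1 != e2.1.
  apply: contra ne => /eqP ejk; apply/eqP; apply: arc_overlap_eq => //.
    by rewrite e12 x_arc.
  by rewrite -e12 x_arc.
have [s [ls os1 os2]] : exists s, [/\ x e1.2.1 < s, over e1 s & over e2 s].
  exists (Num.min (x e1.2.2) (x e2.2.2)).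
  rewrite /over -e12 lt_min !ge_min !le_min !lexx orbT /=.
  by rewrite x_arc // e12 x_arc // -e12 !ltW ?x_arc // e12 x_arc.
have o1 := over_left a1; have o2 := over_left a2.
have [lt|gt|eq] := ltgtP (g e1.1 s) (g e2.1 s).
- case/negP: top1; apply/existsP; exists e2; rewrite /above_at_left eF2 e12 eqxx /=.
  by apply/asboolP; exists s.
- case/negP: top2; apply/existsP; exists e1; rewrite /above_at_left eF1 e12 eqxx /=.
  by apply/asboolP; exists s.
have y1 := y_left a1; have y2 := y_left a2.
rewrite -e12 in o2 y2; rewrite y1 in y2.
exact: (meet_once jk (dom_over a1 o1) (dom_over a2 o2) (dom_over a1 os1)
  (dom_over a2 os2) ls y2 eq).
Qed.

Lemma top_right_inj : {in [set e in F | ~~ [exists e', above_at_right e e']] &,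
  injective (fun e : arc => e.2.2)}.
Proof.
move=> e1 e2; rewrite !inE => /andP[eF1 top1] /andP[eF2 top2] e12.
have [a1 a2] := (F_arc eF1, F_arc eF2).
apply/eqP; apply/negPn/negP => ne.
have jk : e1.1 != e2.1.
  apply: contra ne => /eqP ejk; apply/eqP; apply: arc_overlap_eq => //.
    by rewrite -e12 x_arc.
  by rewrite e12 x_arc.
have [s [ls os1 os2]] : exists s, [/\ s < x e1.2.2, over e1 s & over e2 s].
  exists (Num.max (x e1.2.1) (x e2.2.1)).
  rewrite /over -e12 gt_max !le_max !ge_max !lexx orbT /=.
  by rewrite x_arc // e12 x_arc // -e12 !ltW ?x_arc // e12 x_arc.
have o1 := over_right a1; have o2 := over_right a2.
have [lt|gt|eq] := ltgtP (g e1.1 s) (g e2.1 s).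
- case/negP: top1; apply/existsP; exists e2; rewrite /above_at_right eF2 e12 eqxx /=.
  by apply/asboolP; exists s.
- case/negP: top2; apply/existsP; exists e1; rewrite /above_at_right eF1 e12 eqxx /=.
  by apply/asboolP; exists s.
have y1 := y_right a1; have y2 := y_right a2.
rewrite -e12 in o2 y2; rewrite y1 in y2.
exact: (meet_once jk (dom_over a1 os1) (dom_over a2 os2) (dom_over a1 o1)
  (dom_over a2 o2) ls eq y2).
Qed.

(** Both arcs have the same height at [x w]. Absence of crossings orders them the same way at both
    ends of their common interval, and [g_between] then makes the order strict at [x w]. *)
Lemma sees_inj e1 e2 w : e1 \in F -> e2 \in F -> sees e1 w -> sees e2 w -> e1 = e2.
Proof.
move=> eF1 eF2 /andP[/andP[x1 l1] /forall_inP s1] /andP[/andP[x2 l2] /forall_inP s2].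
have [a1 a2] := (F_arc eF1, F_arc eF2).
have eq : g e1.1 (x w) = g e2.1 (x w).
  apply/le_anti; have /implyP-> := s1 _ eF2; rewrite ?x2 ?l2 //.
  by have /implyP-> := s2 _ eF1; rewrite ?x1 ?l1.
apply/eqP; apply/negPn/negP => ne.
case/andP: (x1) (x2) => x11 x12 /andP[x21 x22].
have jk : e1.1 != e2.1.
  apply: contra ne => /eqP ejk; apply/eqP; apply: arc_overlap_eq => //; lra.
pose s := Num.max (x e1.2.1) (x e2.2.1); pose t := Num.min (x e1.2.2) (x e2.2.2).
have sw : s < x w by rewrite gt_max x11.
have wt : x w < t by rewrite lt_min x12.
have os1 : over e1 s by rewrite /over le_max lexx /=; lra.
have os2 : over e2 s by rewrite /over le_max lexx orbT /=; lra.
have ot1 : over e1 t by rewrite /over ge_min lexx /= andbT; lra.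
have ot2 : over e2 t by rewrite /over ge_min lexx orbT /= andbT; lra.
have [ds1 ds2] := (dom_over a1 os1, dom_over a2 os2).
have [dt1 dt2] := (dom_over a1 ot1, dom_over a2 ot2).
have dw1 := dom_over a1 (over_lt x1); have dw2 := dom_over a2 (over_lt x2).
have kj : e2.1 != e1.1 by rewrite eq_sym.
have H1 := g_between jk ds1 ds2 dt1 dt2 sw wt.
have H2 := g_between kj ds2 ds1 dt2 dt1 sw wt.
have st := lt_trans sw wt.
have [lt|gt|e] := ltgtP (g e1.1 s) (g e2.1 s).
- have := noncrossing_le eF1 eF2 st os1 ot1 os2 ot2 lt.
  by move/(H1 (ltW lt)); rewrite eq ltxx.
- have := noncrossing_le eF2 eF1 st os2 ot2 os1 ot1 gt.
  by move/(H2 (ltW gt)); rewrite eq ltxx.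
exact: (meet_once jk ds1 ds2 dw1 dw2 sw e eq).
Qed.

(** Arcs leaving the same left end keep their order, so the lowest one can be selected at a single
    abscissa: the smallest of their right ends, over which all of them extend. *)
Lemma exists_lowest_above e : e \in F -> [exists e', above_at_left e e'] ->
  exists2 e', above_at_left e e' &
    forall e2 s, above_at_left e e2 -> x e.2.1 < s -> over e' s -> over e2 s ->
      g e'.1 s <= g e2.1 s.
Proof.
move=> eF /existsP[e0 e0P].
pose P e' := above_at_left e e'.
have exl e' : P e' -> [/\ e' \in F, e'.2.1 = e.2.1 & is_arc e'].
  by case/and3P => h /eqP h' _; split => //; apply: F_arc.
case: (arg_minP (fun e' : arc => x e'.2.2) e0P) => em emP em_min.
have [emF eml ema] := exl _ emP.
pose s0 := x em.2.2.
have us0 : x e.2.1 < s0 by rewrite -eml x_arc.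
have o0 e' : P e' -> over e' s0.
  move=> e'P; have [e'F e'l e'a] := exl _ e'P.
  by rewrite /over e'l ltW //= em_min.
case: (arg_minP (fun e' : arc => g e'.1 s0) e0P) => e1 e1P e1_min.
have [e1F e1l e1a] := exl _ e1P.
exists e1 => // e2 s e2P us os1 os2.
have [e2F e2l e2a] := exl _ e2P.
rewrite leNgt; apply/negP => lt.
have := e1_min _ e2P; rewrite leNgt => /negP; apply.
have o1 := over_left e1a; have o2 := over_left e2a.
have y1 := y_left e1a; have y2 := y_left e2a.
rewrite e1l in o1 y1; rewrite e2l in o2 y2.
apply: (@order_after e2.1 e1.1 (x e.2.1) s s0) => //; try exact: dom_over.
- by apply: (dom_over e2a); apply: o0.
- by apply: (dom_over e1a); apply: o0.
by rewrite -y1 -y2.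
Qed.

(** The wedge between [e] and the lowest arc [e'] above it at the left end contains a vertex, and
    the leftmost such vertex sees [e]. *)
Lemma exists_sees e : e \in F -> [exists e', above_at_left e e'] ->
  [exists e', above_at_right e e'] -> exists2 w, w \in V & sees e w.
Proof.
move=> eF /(exists_lowest_above eF)[e' e'P e'low] /existsP[e'' e''P].
have [e'F /eqP e'l /asboolP[s1 [os1 os1' ls1]]] := and3P e'P.
have [e''F /eqP e''r /asboolP[s2 [os2 os2' ls2]]] := and3P e''P.
have [ae ae' ae''] := And3 (F_arc eF) (F_arc e'F) (F_arc e''F).
have [xe xe' xe''] := And3 (x_arc ae) (x_arc ae') (x_arc ae'').
have yl := y_left ae; have yl' := y_left ae'; rewrite e'l yl in yl'.
have yr := y_right ae; have yr'' := y_right ae''; rewrite e''r yr in yr''.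
have ou := over_left ae; have ou' := over_left ae'; rewrite e'l in ou'.
have ov := over_right ae; have ov'' := over_right ae''; rewrite e''r in ov''.
have us1 : x e.2.1 < s1.
  rewrite lt_neqAle; case/andP: os1 => -> _; rewrite andbT.
  by apply: contraTneq ls1 => <-; rewrite yl' ltxx.
have vs2 : s2 < x e.2.2.
  rewrite lt_neqAle; case/andP: os2 => _ ->; rewrite andbT.
  by apply: contraTneq ls2 => ->; rewrite yr'' ltxx.
have up' s : x e.2.1 < s -> over e s -> over e' s -> g e.1 s < g e'.1 s.
  move=> us os os'.
  apply: (@order_after e.1 e'.1 (x e.2.1) s1 s) => //; exact: dom_over.
have up'' s : s < x e.2.2 -> over e s -> over e'' s -> g e.1 s < g e''.1 s.
  move=> us os os'.
  apply: (@order_before e.1 e''.1 (x e.2.2) s2 s) => //; exact: dom_over.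
pose W w := [&& w \in V, x e.2.1 < x w < x e.2.2, x w <= x e'.2.2,
  g e.1 (x w) < y w & y w <= g e'.1 (x w)].
(* If [e'] stops before the right end of [e], its own right end is in the wedge. Otherwise [e'']
   ends below [e'], so it must start inside the wedge in order not to cross [e']. *)
have [w0 w0W] : exists w, W w.
  have [lt|ge] := ltP (x e'.2.2) (x e.2.2).
    exists e'.2.2; rewrite /W (andP (F_vertices e'F)).2 lt -e'l xe' lexx /=.
    rewrite (y_right ae') lexx andbT; apply: up'; last exact: over_right.
      by rewrite -e'l.
    by rewrite /over -e'l !ltW.
  have ov' : over e' (x e.2.2) by rewrite /over ge e'l ltW.
  have lv := up' _ xe ov ov'.
  have ul : x e.2.1 < x e''.2.1.
    rewrite ltNge; apply/negP => h.
    have ou'' : over e'' (x e.2.1) by rewrite /over h e''r ltW.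
    have lu := up'' _ xe ou ou''.
    have := noncrossing_le e'F e''F xe ou' ov' ou'' ov''.
    by rewrite -yl' => /(_ lu); rewrite -yr'' leNgt lv.
  have lr : x e''.2.1 < x e.2.2 by rewrite -e''r.
  have ol'' := over_left ae''.
  have ol : over e (x e''.2.1) by rewrite /over !ltW.
  have ol' : over e' (x e''.2.1).
    by rewrite /over e'l ltW //= (le_trans _ ge) // ltW.
  exists e''.2.1; rewrite /W (andP (F_vertices e''F)).1 ul lr /=.
  rewrite (le_trans (ltW lr) ge) /= (y_left ae'') up'' //=.
  apply: (noncrossing_le_left e''F e'F lr) => //.
  by rewrite -yr''.
case: (arg_minP x w0W) => w /and5P[wV xw xw' lw lw'] wmin.
exists w => //; rewrite /sees xw lw /=.
apply/forall_inP => e2 e2F; apply/implyP => /andP[xw2 lw2].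
rewrite leNgt; apply/negP => lt.
have ae2 := F_arc e2F.
case/andP: (xw) (xw2) => uw wv /andP[uw2 wv2].
have [ow ow2] := (over_lt xw, over_lt xw2).
have ow' : over e' (x w) by rewrite /over xw' e'l ltW.
have l2' : g e2.1 (x w) < g e'.1 (x w) by exact: lt_le_trans lw2 lw'.
(* An arc [e2] blocking the view is squeezed between [e] and [e'] to the left of [w]. If it starts
   to the right of the left end of [e], its left end is a wedge vertex before [w]. *)
have [lu|gu] := ltP (x e.2.1) (x e2.2.1).
  have oz2 := over_left ae2.
  have oz : over e (x e2.2.1) by rewrite /over; lra.
  have oz' : over e' (x e2.2.1) by rewrite /over e'l; lra.
  have h1 := noncrossing_le_left eF e2F uw2 oz ow oz2 ow2 lt.
  have h2 := noncrossing_le_left e2F e'F uw2 oz2 ow2 oz' ow' l2'.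
  have zW : W e2.2.1.
    rewrite /W (andP (F_vertices e2F)).1 lu (lt_trans uw2 wv) /=.
    rewrite (le_trans (ltW uw2) xw') (y_left ae2) h2 andbT /=.
    rewrite lt_neqAle h1 andbT -(y_left ae2) eq_sym interior_off_arc // lu /=.
    exact: lt_trans wv.
  by have := wmin _ zW; rewrite leNgt uw2.
(* Otherwise [e2] passes through the left end of [e], hence starts there, and contradicts the choice
   of [e'] as lowest. *)
have ou2 : over e2 (x e.2.1) by rewrite /over gu; lra.
have h1 := noncrossing_le_left eF e2F uw ou ow ou2 ow2 lt.
have h2 := noncrossing_le_left e2F e'F uw ou2 ow2 ou' ow' l2'.
have yu : y e.2.1 = g e2.1 (x e.2.1).
  by rewrite yl; apply/le_anti; rewrite h1 yl'.
have xu : x e2.2.1 = x e.2.1.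
  apply/le_anti; rewrite gu /= leNgt; apply/negP => h.
  have := @interior_off_arc e2 e.2.1 ae2.
  by rewrite h yu eqxx (lt_trans uw wv2) => /(_ isT).
have eu : e2.2.1 = e.2.1 by apply: xy_inj; rewrite // (y_left ae2) xu.
have e2P : above_at_left e e2.
  rewrite /above_at_left e2F eu eqxx /=; apply/asboolP; by exists (x w).
by have := e'low _ _ e2P uw ow' ow2; rewrite leNgt l2'.
Qed.

(* Each arc is charged to its left end, if it is the top arc leaving it, or to
   its right end, if it is the top arc entering it, or else to a vertex that
   sees it vertically from above. *)
Lemma card_noncrossing : (#|F| <= 3 * #|V|)%N.
Proof.
pose A := [set e in F | ~~ [exists e', above_at_left e e']].
pose B := [set e in F | ~~ [exists e', above_at_right e e']].
pose C := [set e in F | [exists e', above_at_left e e'] && [exists e', above_at_right e e']].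
have sub : F \subset A :|: B :|: C.
  apply/subsetP => e eF; rewrite !inE eF /=.
  by case: [exists e', above_at_left _ _]; case: [exists e', above_at_right _ _].
have cA : (#|A| <= #|V|)%N.
  rewrite -(card_in_imset top_left_inj); apply/subset_leq_card/subsetP => u.
  by case/imsetP => e; rewrite inE => /andP[/F_vertices/andP[h _] _] ->.
have cB : (#|B| <= #|V|)%N.
  rewrite -(card_in_imset top_right_inj); apply/subset_leq_card/subsetP => u.
  by case/imsetP => e; rewrite inE => /andP[/F_vertices/andP[_ h] _] ->.
have cC : (#|C| <= #|V|)%N.
  pose c e := odflt e.2.1 [pick w in V | sees e w].
  have cP e : e \in C -> (c e \in V) && sees e (c e).
    rewrite inE => /and3P[eF h1 h2]; rewrite /c.
    case: pickP => [w /andP[-> ->] //|no].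
    by have [w wV sw] := exists_sees eF h1 h2; have := no w; rewrite wV sw.
  have cI : {in C &, injective c}.
    move=> e1 e2 C1 C2 ce.
    have [/andP[_ s1] /andP[_ s2]] := (cP _ C1, cP _ C2).
    move: C1 C2; rewrite !inE => /andP[f1 _] /andP[f2 _].
    by apply: (sees_inj f1 f2 s1); rewrite ce.
  rewrite -(card_in_imset cI); apply/subset_leq_card/subsetP => w.
  by case/imsetP => e /cP/andP[h _] ->.
apply: leq_trans (subset_leq_card sub) _.
have := cardsUI (A :|: B) C; have := cardsUI A B; lia.
Qed.

End NonCrossing.

Definition arcs : {set arc} := [set e | is_arc e].
Definition crossings : {set arc * arc} :=
  [set c | [&& is_arc c.1, is_arc c.2 & crossing c.1 c.2]].
Definition incidences : {set J * I} := [set ju | on ju.1 ju.2].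

Lemma card_crossings : (#|crossings| <= #|J| ^ 2)%N.
Proof.
pose f (c : arc * arc) := (c.1.1, c.2.1).
have fI : {in crossings &, injective f}.
  move=> [e1 e1'] [e2 e2']; rewrite !inE /= => /and3P[a1 a1' c1] /and3P[a2 a2' c2].
  by case; exact: crossing_unique.
by rewrite -(card_in_imset fI) -mulnn -card_prod max_card.
Qed.

(** Every incidence except the rightmost one of its curve is the left end of an arc. *)
Lemma card_incidences : (#|incidences| <= #|J| + #|arcs|)%N.
Proof.
pose has_next (ju : J * I) := [exists w, on ju.1 w && (x ju.2 < x w)].
pose L := [set ju in incidences | ~~ has_next ju].
have sub : incidences \subset L :|: [set (e.1, e.2.1) | e in arcs].
  apply/subsetP => -[j u] ju; rewrite in_setU [_ \in L]inE ju /=.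
  case hn : (has_next _) => //=; case/existsP: hn => w0 /= w0P.
  case: (@arg_minP _ _ _ w0 (fun w => on j w && (x u < x w)) x w0P).
  move=> w /andP[jw uw] wmin; apply/imsetP; exists (j, (u, w)) => //.
  rewrite !inE in ju *; rewrite /is_arc /= jw ju uw /=.
  apply/forallP => w'; apply/implyP => jw'; apply/negP => /andP[uw' w'w].
  by have := wmin w'; rewrite jw' uw' leNgt w'w => /(_ isT).
apply: leq_trans (subset_leq_card sub) _.
apply: leq_trans (leq_card_setU _ _) _; apply: leq_add (leq_imset_card _ _).
have LI : {in L &, injective (fun ju : J * I => ju.1)}.
  move=> [j u] [k v]; rewrite !inE /= => /andP[ju lu] /andP[kv lv] ejk; subst k.
  case/andP: (ju) (kv) => _ /eqP yu /andP[_ /eqP yv].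
  have xuv : x u = x v.
    have [lt|gt|//] := ltgtP (x u) (x v).
      by case/existsP: lu; exists v; rewrite kv lt.
    by case/existsP: lv; exists u; rewrite ju gt.
  by congr (_, _); apply: xy_inj; rewrite // yu yv xuv.
by rewrite -(card_in_imset LI) max_card.
Qed.

(** Deleting the first arc of each sampled crossing leaves a family to which [card_noncrossing]
    applies. *)
Lemma card_arcs_sample (V : {set I}) :
  (#|[set e in arcs | (e.2.1 \in V) && (e.2.2 \in V)]| <= 3 * #|V| +
   #|[set c in crossings | [set c.1.2.1; c.1.2.2; c.2.2.1; c.2.2.2] \subset V]|)%N.
Proof.
set E := [set e in arcs | _]; set X := [set c in crossings | _].
have sub : E \subset (E :\: (fst @: X)) :|: (fst @: X).
  by apply/subsetP => e eE; rewrite in_setU in_setD eE; case: (e \in _).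
apply: leq_trans (subset_leq_card sub) _.
apply: leq_trans (leq_card_setU _ _) _; apply: leq_add (leq_imset_card _ _).
apply: card_noncrossing => [e|e|e e'].
- by rewrite !inE => /andP[_ /andP[]].
- by rewrite !inE => /andP[_ /andP[]].
move=> /setDP[eE eX] /setDP[e'E _]; apply: contra eX => cr.
apply/imsetP; exists (e, e') => //.
move: eE e'E; rewrite !inE => /and3P[-> h1 h2] /and3P[-> h3 h4] /=.
by rewrite cr !subUset !sub1set h1 h2 h3 h4.
Qed.

(** Average [card_arcs_sample] over [V]: an arc survives with probability [p ^+ 2], a vertex with
    [p], a crossing with [p ^+ 4]. Then divide by [p ^+ 2]. *)
Lemma incidence_bound (p : R) : 0 < p -> p <= 1 ->
  #|incidences|%:R <= #|J|%:R + 3 * #|I|%:R / p + p ^+ 2 * #|J|%:R ^+ 2.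
Proof.
move=> p0 p1.
have w0 V : 0 <= @sample_weight R I p V.
  by apply: prodr_ge0 => i _; case: ifP => _; lra.
have key : \sum_V @sample_weight R I p V *
    #|[set e in arcs | [set e.2.1; e.2.2] \subset V]|%:R <=
  3 * (\sum_V @sample_weight R I p V * #|[set i in [set: I] | [set i] \subset V]|%:R) +
  \sum_V @sample_weight R I p V *
    #|[set c in crossings | [set c.1.2.1; c.1.2.2; c.2.2.1; c.2.2.2] \subset V]|%:R.
  rewrite mulr_sumr -big_split /=; apply: ler_sum => V _.
  rewrite mulrCA -mulrDr ler_wpM2l // -natrM -natrD ler_nat.
  have -> : [set i in [set: I] | [set i] \subset V] = V.
    by apply/setP => i; rewrite !inE sub1set.
  apply: leq_trans (card_arcs_sample V); apply: subset_leq_card.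
  by apply/subsetP => e; rewrite !inE subUset !sub1set.
rewrite !(@sum_sample_card R) in key.
rewrite (eq_bigr (fun=> p ^+ 2)) in key; last first.
  move=> e; rewrite inE => /x_arc xe; rewrite cards2.
  by case: eqP xe => // ->; rewrite ltxx.
rewrite [X in _ <= 3 * X + _](eq_bigr (fun=> p)) in key; last first.
  by move=> i _; rewrite cards1.
rewrite [X in _ <= _ + X](eq_bigr (fun=> p ^+ 4)) in key; last first.
  move=> [e e']; rewrite inE => /and3P[a a' cr].
  have /= := crossing_disjoint a a' cr; rewrite !inE !negb_or => U.
  by rewrite -!setUA !cardsU1 cards1 !inE !negb_or; case/and4P: U => -> -> ->.
rewrite !sumr_const cardsT -(mulr_natr (p ^+ 2)) -(mulr_natr p) -(mulr_natr (p ^+ 4)) in key.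
have hX : #|crossings|%:R <= #|J|%:R ^+ 2 :> R by rewrite -natrX ler_nat card_crossings.
have hI : #|incidences|%:R <= #|J|%:R + #|arcs|%:R :> R.
  by rewrite -natrD ler_nat card_incidences.
apply: le_trans hI _; rewrite -addrA lerD2l.
have p2 : 0 < p ^+ 2 by rewrite exprn_gt0.
rewrite -(ler_pM2l p2); apply: le_trans key _.
have -> : p ^+ 2 * (3 * #|I|%:R / p + p ^+ 2 * #|J|%:R ^+ 2) =
   3 * (p * #|I|%:R) + p ^+ 4 * #|J|%:R ^+ 2 by field; lra.
by rewrite lerD2l ler_wpM2l // exprn_ge0 // ltW.
Qed.

End PseudoSegments.

(** * Strict concavity of the semicircle and its translates *)

Section Circles.
Variable R : realType.
Implicit Types (a b r s t u v : R).

Definition semicircle r z := Num.sqrt (r ^+ 2 - z ^+ 2).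

Lemma semicircle_sqr r z : 0 < r -> `|z| <= r -> semicircle r z ^+ 2 = r ^+ 2 - z ^+ 2.
Proof.
move=> r0 zr; rewrite sqr_sqrtr // subr_ge0 -[z ^+ 2]real_normK ?num_real //.
by rewrite ler_pXn2r ?nnegrE // ltW.
Qed.

Lemma semicircle_concave r u v l : 0 < r -> `|u| <= r -> `|v| <= r -> u != v ->
  0 < l -> l < 1 ->
  l * semicircle r u + (1 - l) * semicircle r v < semicircle r (l * u + (1 - l) * v).
Proof.
move=> r0 ur vr uv l0 l1.
have zr : `|l * u + (1 - l) * v| <= r.
  by move: ur vr; rewrite !ler_norml => /andP[? ?] /andP[? ?]; apply/andP; split; nra.
have := semicircle_sqr r0 ur; have := semicircle_sqr r0 vr; have := semicircle_sqr r0 zr.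
have : 0 <= semicircle r u by exact: sqrtr_ge0.
have : 0 <= semicircle r v by exact: sqrtr_ge0.
have : 0 <= semicircle r (l * u + (1 - l) * v) by exact: sqrtr_ge0.
set z := semicircle r (_ + _); set p := semicircle r u; set q := semicircle r v.
move=> z0 q0 p0 ez eq ep.
rewrite -(ltr_pXn2r (n := 2)) ?nnegrE //; last first.
  by rewrite addr_ge0 // mulr_ge0 //; lra.
have duv : 0 < (u - v) ^+ 2 by rewrite exprn_even_gt0 //= subr_eq0.
have dpq : 0 <= (p - q) ^+ 2 by rewrite sqr_ge0.
rewrite ez -subr_gt0.
(* The last two summands vanish by the circle equations; the first is positive because [u != v]. *)
have -> : r ^+ 2 - (l * u + (1 - l) * v) ^+ 2 - (l * p + (1 - l) * q) ^+ 2 =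
  l * (1 - l) * ((u - v) ^+ 2 + (p - q) ^+ 2) + l * (r ^+ 2 - u ^+ 2 - p ^+ 2) +
  (1 - l) * (r ^+ 2 - v ^+ 2 - q ^+ 2) by ring.
rewrite ep eq !subrr !mulr0 !addr0 mulr_gt0 //; last by lra.
by rewrite mulr_gt0 //; lra.
Qed.

(* The outer arguments [s - b] and [t - a] have the same sum as the inner ones
   [s - a] and [t - b], which are complementary convex combinations of them. *)
Lemma semicircle_sub_mono r a b s t : 0 < r -> a < b -> s < t ->
  `|s - a| <= r -> `|s - b| <= r -> `|t - a| <= r -> `|t - b| <= r ->
  semicircle r (t - a) - semicircle r (t - b) <
  semicircle r (s - a) - semicircle r (s - b).
Proof.
move=> r0 ab st sa sb ta tb.
pose D := (b - a) + (t - s).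
have D0 : 0 < D by rewrite /D; lra.
have uv : s - b != t - a by apply/eqP => E; move: D0; rewrite /D; lra.
pose l := (b - a) / D.
have lD : l * D = b - a by rewrite /l divfK // gt_eqF.
have l0 : 0 < l by rewrite divr_gt0 // subr_gt0.
have l1 : l < 1 by rewrite ltr_pdivrMr // mul1r /D; lra.
have h1 := semicircle_concave r0 sb ta uv l0 l1.
have h2 := @semicircle_concave r _ _ (1 - l) r0 sb ta uv.
have e1 : l * (s - b) + (1 - l) * (t - a) = t - b.
  by rewrite -[RHS]addr0 -(subrr (l * D)) {1}lD /D; ring.
have e2 : (1 - l) * (s - b) + (1 - (1 - l)) * (t - a) = s - a.
  by rewrite -[RHS]addr0 -(subrr (l * D)) {2}lD /D; ring.
rewrite e1 in h1; rewrite e2 in h2.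
have h2' := h2 ltac:(lra) ltac:(lra).
lra.
Qed.

(** The difference of two translates is strictly monotone, so the inequality at one end, chosen by
    the order of [a] and [b], already implies the one at [m]. For [a = b] the difference is a
    nonzero constant. *)
Lemma semicircle_between r a b ya yb s m t : 0 < r -> (a, ya) != (b, yb) ->
  `|s - a| <= r -> `|s - b| <= r -> `|t - a| <= r -> `|t - b| <= r ->
  s < m -> m < t ->
  ya + semicircle r (s - a) <= yb + semicircle r (s - b) ->
  ya + semicircle r (t - a) <= yb + semicircle r (t - b) ->
  ya + semicircle r (m - a) < yb + semicircle r (m - b).
Proof.
move=> r0 ne sa sb ta tb sm mt hs ht.
have ma : `|m - a| <= r by move: sa ta; rewrite !ler_norml; lra.
have mb : `|m - b| <= r by move: sb tb; rewrite !ler_norml; lra.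
have [ab|ba|eab] := ltgtP a b.
- by have := semicircle_sub_mono r0 ab sm sa sb ma mb; lra.
- by have := semicircle_sub_mono r0 ba mt mb ma tb ta; lra.
subst b; rewrite ltrD2r lt_neqAle; apply/andP; split.
  by apply: contra ne => /eqP->.
by move: hs; rewrite lerD2r.
Qed.

End Circles.

(** * Cube roots of natural numbers *)

Section CubeRoot.
Variable R : realType.

(** In terms of cube roots all bounds with exponents in thirds become polynomial, within reach of
    [ring] and [lra]. *)
Definition cbrt (n : nat) : R := n%:R `^ 3^-1.

Lemma cbrt_ge0 n : 0 <= cbrt n. Proof. exact: powR_ge0. Qed.

Lemma cbrtK n : cbrt n ^+ 3 = n%:R.
Proof. by rewrite -powR_mulrn ?cbrt_ge0 // -powRrM mulVf ?pnatr_eq0 ?powRr1. Qed.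

Lemma ler_cbrt m n : (m <= n)%N -> cbrt m <= cbrt n.
Proof. by move=> mn; rewrite ge0_ler_powR ?nnegrE ?ler_nat ?invr_ge0. Qed.

Lemma cbrtM m n : cbrt (m * n) = cbrt m * cbrt n.
Proof. by rewrite /cbrt natrM powRM. Qed.

Lemma cbrt1 : cbrt 1 = 1. Proof. by rewrite /cbrt powR1. Qed.

Lemma cbrt_ge1 n : (0 < n)%N -> 1 <= cbrt n.
Proof. by move=> n0; rewrite -cbrt1 ler_cbrt. Qed.

Lemma cbrt_double n : cbrt (2 * n) <= 2 * cbrt n.
Proof.
rewrite cbrtM ler_wpM2r ?cbrt_ge0 // -(ler_pXn2r (n := 3)) ?nnegrE ?cbrt_ge0 //.
by rewrite cbrtK; lra.
Qed.

End CubeRoot.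

(** * Repeated distances in the real plane *)

Section UnitDistances.
Variables (R : realType) (d : R).
Hypothesis d_gt0 : 0 < d.
Local Notation r := (Num.sqrt d).

Definition sqdist (p q : R * R) := (p.1 - q.1) ^+ 2 + (p.2 - q.2) ^+ 2.

Lemma sqdistC p q : sqdist p q = sqdist q p.
Proof. by rewrite /sqdist; ring. Qed.

Let r_gt0 : 0 < r. Proof. by rewrite sqrtr_gt0. Qed.
Let r_sqr : r ^+ 2 = d. Proof. by rewrite sqr_sqrtr // ltW. Qed.

Lemma upper_incidenceE (p q : R * R) :
  (sqdist p q == d) && (q.2 <= p.2) =
  (`|p.1 - q.1| <= r) && (p.2 == q.2 + semicircle r (p.1 - q.1)).
Proof.
apply/andP/andP => [[/eqP dpq qp]|[pr /eqP ep]].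
  have le : (p.1 - q.1) ^+ 2 <= r ^+ 2.
    by rewrite r_sqr -dpq lerDl sqr_ge0.
  split; first by rewrite -(ler_pXn2r (n := 2)) ?nnegrE // ?real_normK ?num_real // ltW.
  rewrite /semicircle r_sqr -dpq addrAC subrr add0r sqrtr_sqr ger0_norm ?subr_ge0 //.
  by rewrite addrC subrK.
rewrite ep lerDl sqrtr_ge0; split=> //.
by rewrite /sqdist ep [q.2 + _]addrC addrK semicircle_sqr // r_sqr addrC subrK.
Qed.

Lemma upper_incidences_le (I J : finType) (c : I -> R * R) (c' : J -> R * R) :
  injective c -> injective c' ->
  #|[set ji : J * I | (sqdist (c ji.2) (c' ji.1) == d) &&
      ((c' ji.1).2 <= (c ji.2).2)]|%:R <=
  cbrt R #|J| ^+ 3 + 4 * cbrt R #|I| ^+ 2 * cbrt R #|J| ^+ 2 + 4 * cbrt R #|I| ^+ 3.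
Proof.
move=> cI cJ.
pose dom j s := `|s - (c' j).1| <= r.
pose h j s := (c' j).2 + semicircle r (s - (c' j).1).
have xy u v : (c u).1 = (c v).1 -> (c u).2 = (c v).2 -> u = v.
  by move=> h1 h2; apply: cI; rewrite [c u]surjective_pairing h1 h2 -surjective_pairing.
have dcvx j s m t : dom j s -> dom j t -> s <= m -> m <= t -> dom j m.
  by rewrite /dom !ler_norml; lra.
have btw j k s m t : j != k -> dom j s -> dom k s -> dom j t -> dom k t ->
    s < m -> m < t -> h j s <= h k s -> h j t <= h k t -> h j m < h k m.
  move=> jk; apply: semicircle_between => //.
  by rewrite -!surjective_pairing (inj_eq cJ).
have bound := incidence_bound xy dcvx btw.
set S := [set ji | _].
have -> : S = incidences (fun i => (c i).1) (fun i => (c i).2) dom h.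
  by apply/setP => -[j i]; rewrite !inE /= upper_incidenceE.
set a := cbrt R #|I|; set b := cbrt R #|J|.
have [a0 b0] : 0 <= a /\ 0 <= b by rewrite !cbrt_ge0.
rewrite -(cbrtK R #|I|) -(cbrtK R #|J|) -/a -/b in bound.
(* The optimal probability [a / b ^+ 2] balances the two main terms. When it exceeds 1, [p = 1] is
   taken and [b ^+ 6 <= a ^+ 3] absorbs the crossings. *)
have [lt|le] := ltP (b ^+ 2) a.
  apply: le_trans (bound 1 ltr01 (lexx _)) _.
  have : (b ^+ 2) ^+ 3 <= a ^+ 3 by rewrite lerXn2r ?nnegrE ?exprn_ge0 // ltW.
  have : 0 <= a ^+ 2 * b ^+ 2 by rewrite mulr_ge0 ?exprn_ge0.
  by rewrite -exprM expr1n divr1 mul1r -exprM; lra.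
have [I0|I1] := posnP #|I|.
  have -> : incidences (fun i => (c i).1) (fun i => (c i).2) dom h = set0.
    apply/setP => -[j i]; have := fintype0 i; by move/(_ I0).
  by rewrite cards0 !(addr_ge0, mulr_ge0, exprn_ge0).
have a1 : 1 <= a by rewrite cbrt_ge1.
have b2 : 0 < b ^+ 2 by lra.
have b_neq0 : b != 0 by apply: contraTneq b2 => ->; rewrite expr0n ltxx.
have ab0 : 0 < a / b ^+ 2 by rewrite divr_gt0 //; lra.
have ab1 : a / b ^+ 2 <= 1 by rewrite ler_pdivrMr // mul1r.
apply: le_trans (bound _ ab0 ab1) _.
have -> : b ^+ 3 + 3 * a ^+ 3 / (a / b ^+ 2) + (a / b ^+ 2) ^+ 2 * (b ^+ 3) ^+ 2
  = b ^+ 3 + 4 * a ^+ 2 * b ^+ 2 by field; rewrite b_neq0 /=; lra.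
by rewrite lerDl mulr_ge0 ?exprn_ge0.
Qed.

(** In each pair one point is at least as high as the other, hence on the upper semicircle centred
    at it. The semicircle bound is applied once for each choice of the centres. *)
Lemma unit_distances_le (I J : finType) (c : I -> R * R) (c' : J -> R * R) :
  injective c -> injective c' ->
  #|[set ij : I * J | sqdist (c ij.1) (c' ij.2) == d]|%:R <=
  8 * (cbrt R #|I| ^+ 2 * cbrt R #|J| ^+ 2 + cbrt R #|I| ^+ 3 + cbrt R #|J| ^+ 3).
Proof.
move=> cI cJ.
have h1 := upper_incidences_le cI cJ; have h2 := upper_incidences_le cJ cI.
set S := [set ij | _].
set U := [set ji | _] in h1; set U' := [set ji | _] in h2.
have sub : S \subset [set (ji.2, ji.1) | ji in U] :|: U'.
  apply/subsetP => -[i j]; rewrite !inE /= sqdistC => dij.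
  apply/orP; have [le|lt] := leP (c' j).2 (c i).2; [left|right].
    by apply/imsetP; exists (j, i); rewrite // inE /= sqdistC dij.
  by rewrite dij ltW.
have : (#|S| <= #|U| + #|U'|)%N.
  apply: leq_trans (subset_leq_card sub) _.
  by apply: leq_trans (leq_card_setU _ _) _; rewrite leq_add2r leq_imset_card.
rewrite -(ler_nat R) natrD.
have : 0 <= cbrt R #|I| ^+ 3 by rewrite exprn_ge0 // cbrt_ge0.
have : 0 <= cbrt R #|J| ^+ 3 by rewrite exprn_ge0 // cbrt_ge0.
by lra.
Qed.

Lemma unit_distances_set_le (T : finType) (c : T -> R * R) (A B : {set T}) :
  {in A &, injective c} -> {in B &, injective c} ->
  #|[set pq | [&& pq.1 \in A, pq.2 \in B & sqdist (c pq.1) (c pq.2) == d]]|%:R <=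
  8 * (cbrt R #|A| ^+ 2 * cbrt R #|B| ^+ 2 + cbrt R #|A| ^+ 3 + cbrt R #|B| ^+ 3).
Proof.
move=> cA cB; set S := [set pq | _].
pose cS (X : {set T}) (t : {t | t \in X}) := c (val t).
have iA : injective (@cS A).
  by move=> s t /cA-/(_ (valP s) (valP t)) /val_inj.
have iB : injective (@cS B).
  by move=> s t /cB-/(_ (valP s) (valP t)) /val_inj.
have := unit_distances_le iA iB; rewrite !card_sig; apply: le_trans.
set S' := [set ij | _]; rewrite ler_nat.
have sub : S \subset [set (val ij.1, val ij.2) | ij in S'].
  apply/subsetP => -[p q]; rewrite inE /= => /and3P[pA qB dpq].
  by apply/imsetP; exists (exist _ p pA, exist _ q qB); rewrite // inE.
exact: leq_trans (subset_leq_card sub) (leq_imset_card _ _).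
Qed.

End UnitDistances.

(** * Fibres of a planar map and their dyadic sizes *)

Lemma card_le_sum_fibres (R : numDomainType) (X Y : finType) (S : {set X}) (O : {set Y})
    (h : X -> Y) (w : Y -> R) :
  {in S, forall s, h s \in O} ->
  {in O, forall o, #|[set s in S | h s == o]|%:R <= w o} ->
  #|S|%:R <= \sum_(o in O) w o.
Proof.
move=> hO hw; rewrite -sum1_card (partition_big h (mem O)) //= natr_sum.
apply: ler_sum => o /hw; congr (_%:R <= _); rewrite -sum1_card.
by apply: eq_bigl => s; rewrite !inE.
Qed.

Section Fibres.
Variables (R : realType) (T : finType) (f g : T -> R * R) (M : nat).
Hypothesis fg_inj : forall s t, f s = f t -> g s = g t -> s = t.
Hypothesis fibre_le : forall t, (#|[set s | f s == f t]| <= M)%N.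

(** A canonical point of the fibre of [t]. The default is never reached, since [t] itself qualifies,
    so the result depends only on [f t]. *)
Definition rep t := odflt t [pick s | f s == f t].
Definition fibre a := [set t | rep t == a].
Definition reps := [set a | rep a == a].

Lemma f_rep t : f (rep t) = f t.
Proof. by rewrite /rep; case: pickP => [s /eqP|]. Qed.

Lemma eq_rep s t : f s = f t -> rep s = rep t.
Proof.
rewrite /rep => E; rewrite (eq_pick (Q := fun u => f u == f t)); last by move=> u /=; rewrite E.
by case: pickP => // no; have := no t; rewrite eqxx.
Qed.

Lemma rep_reps t : rep t \in reps.
Proof. by rewrite inE (eq_rep (f_rep t)). Qed.

Lemma f_inj_reps : {in reps &, injective f}.
Proof. by move=> a b; rewrite !inE => /eqP ra /eqP rb /eq_rep; rewrite ra rb. Qed.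

Lemma g_inj_fibre a : {in fibre a &, injective g}.
Proof.
move=> s t; rewrite !inE => /eqP rs /eqP rt; apply: fg_inj.
by rewrite -f_rep rs -rt f_rep.
Qed.

Lemma fibre_gt0 a : a \in reps -> (0 < #|fibre a|)%N.
Proof. by rewrite inE => ra; apply/card_gt0P; exists a; rewrite inE. Qed.

Lemma card_fibre_le a : a \in reps -> (#|fibre a| <= M)%N.
Proof.
rewrite inE => /eqP ra; apply: leq_trans (fibre_le a).
by apply/subset_leq_card/subsetP => t; rewrite !inE -(f_rep t) => /eqP->.
Qed.

Lemma sum_fibre (A : {set T}) : (\sum_(a in A) #|fibre a| <= #|T|)%N.
Proof.
apply: leq_trans (_ : (\sum_a #|fibre a| <= _)%N).
  by rewrite [X in (X <= _)%N]big_mkcond leq_sum // => a _; case: ifP.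
rewrite -cardsT -(sum1_card (mem [set: T])) [X in (_ <= X)%N](partition_big rep xpredT) //=.
apply: leq_sum => a _; rewrite -sum1_card.
by apply: eq_leq; apply: eq_bigl => t; rewrite !inE.
Qed.

Lemma same_fibre_le d : 0 < d ->
  #|[set pq | (f pq.1 == f pq.2) && (sqdist (g pq.1) (g pq.2) == d)]|%:R <=
  24 * #|T|%:R * cbrt R M.
Proof.
move=> d0; set S := [set pq | _].
pose w a := 24 * cbrt R M * #|fibre a|%:R.
apply: (@le_trans _ _ (\sum_(a in reps) w a)); last first.
  rewrite -mulr_sumr -mulrA [cbrt R M * _]mulrC mulrA ler_wpM2r ?cbrt_ge0 //.
  by rewrite ler_wpM2l // -natr_sum ler_nat sum_fibre.
apply: (@card_le_sum_fibres _ _ _ _ _ (fun pq => rep pq.1)) => [pq _|a aR].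
  exact: rep_reps.
have := unit_distances_set_le d0 (@g_inj_fibre a) (@g_inj_fibre a).
set k := #|fibre a|; move=> H.
apply: (le_trans _ (le_trans H _)).
  rewrite ler_nat; apply/subset_leq_card/subsetP => -[p q]; rewrite !inE /=.
  by case/andP=> /andP[/eqP/eq_rep <- ->] ->.
(* With [x] and [m] the cube roots of [k] and [M], the bound [8 * (x ^+ 4 + 2 * x ^+ 3)] is at most
   [24 * x ^+ 3 * m] because [1 <= x <= m]. *)
rewrite /w -(cbrtK R k).
have k1 : 1 <= cbrt R k by rewrite cbrt_ge1 // fibre_gt0.
have kM : cbrt R k <= cbrt R M by rewrite ler_cbrt // card_fibre_le.
move: (cbrt R k) (cbrt R M) k1 kM => x m x1 xm.
have x3 : 0 <= x ^+ 3 by rewrite exprn_ge0 //; lra.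
have : x ^+ 3 * 1 <= x ^+ 3 * m by rewrite ler_wpM2l //; lra.
have : x ^+ 3 * x <= x ^+ 3 * m by rewrite ler_wpM2l //; lra.
have -> : x ^+ 2 * x ^+ 2 = x ^+ 3 * x by ring.
by lra.
Qed.

Definition level a := trunc_log 2 #|fibre a|.
Definition reps_at i := [set a in reps | level a == i].

Lemma reps_atP i a : a \in reps_at i -> (2 ^ i <= #|fibre a| < 2 ^ i.+1)%N.
Proof. by rewrite inE => /andP[/fibre_gt0 a0 /eqP<-]; exact: trunc_log_bounds. Qed.

Lemma card_reps_at i : (#|reps_at i| * 2 ^ i <= #|T|)%N.
Proof.
apply: leq_trans (sum_fibre (reps_at i)); rewrite -sum_nat_const.
by apply: leq_sum => a /reps_atP/andP[].
Qed.

(** Fibre sizes are rounded up to [2 ^ i.+1], which costs a factor 2. A nonempty class provides a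
    fibre of size between [2 ^ i] and [M]. *)
Lemma reps_at_cbrt i : reps_at i != set0 ->
  [/\ 1 <= cbrt R (2 ^ i.+1), cbrt R (2 ^ i.+1) <= 2 * cbrt R M &
      cbrt R #|reps_at i| * cbrt R (2 ^ i.+1) <= 2 * cbrt R #|T|].
Proof.
case/set0Pn => a ai; split.
- by rewrite cbrt_ge1 // expn_gt0.
- apply: le_trans (cbrt_double R M); rewrite ler_cbrt // expnS leq_mul2l /=.
  case/andP: (reps_atP ai) => h _; apply: leq_trans h _.
  by apply: card_fibre_le; move: ai; rewrite inE => /andP[].
apply: le_trans (cbrt_double R #|T|); rewrite -cbrtM ler_cbrt //.
by rewrite expnS mulnCA leq_mul2l card_reps_at.
Qed.

End Fibres.

(* With [a = |A_i|^(1/3)], [s = (2^(i+1))^(1/3)] for one dyadic class of fibres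
   and [b], [t] for the other: the number of pairs of fibres at the prescribed
   distance times the number of pairs inside each pair of fibres. *)
Lemma dyadic_product_le (R : realDomainType) (a b s t n m : R) :
  0 <= a -> 0 <= b -> 1 <= s -> 1 <= t -> s <= m -> t <= m ->
  a * s <= n -> b * t <= n ->
  (a ^+ 2 * b ^+ 2 + a ^+ 3 + b ^+ 3) * (s ^+ 2 * t ^+ 2 + s ^+ 3 + t ^+ 3) <=
  3 * (n ^+ 4 * m) + 6 * (n ^+ 3 * m ^+ 3).
Proof.
move=> a0 b0 s1 t1 sm tm asn btn.
have s0 : 0 <= s by lra. have t0 : 0 <= t by lra. have m0 : 0 <= m by lra.
have m1 : 1 <= m by lra.
have as0 : 0 <= a * s by rewrite mulr_ge0.
have bt0 : 0 <= b * t by rewrite mulr_ge0.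
have n0 : 0 <= n by lra.
have an : a <= n by apply: le_trans asn; rewrite ler_peMr.
have bn : b <= n by apply: le_trans btn; rewrite ler_peMr.
have pw (x z : R) k : 0 <= x -> x <= z -> x ^+ k <= z ^+ k.
  by move=> x0 xz; rewrite lerXn2r ?nnegrE // (le_trans x0).
have pr (x x' z z' : R) : 0 <= x -> 0 <= z -> x <= x' -> z <= z' -> x * z <= x' * z'.
  by move=> *; apply: ler_pM.
have ge0 (x : R) k : 0 <= x -> 0 <= x ^+ k by apply: exprn_ge0.
have m3 : 1 <= m ^+ 3 by rewrite exprn_ege1.
(* The nine terms of the expanded product: [q1] to [q3] give [n ^+ 4 * m], the other six give
   [n ^+ 3 * m ^+ 3]. *)
have q1 : (a * s) ^+ 2 * (b * t) ^+ 2 * 1 <= n ^+ 2 * n ^+ 2 * m.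
  by rewrite !pr ?mulr_ge0 ?ge0 ?pw.
have q2 : (a * s) ^+ 2 * b ^+ 2 * s <= n ^+ 2 * n ^+ 2 * m.
  by rewrite !pr ?mulr_ge0 ?ge0 ?pw.
have q3 : a ^+ 2 * (b * t) ^+ 2 * t <= n ^+ 2 * n ^+ 2 * m.
  by rewrite !pr ?mulr_ge0 ?ge0 ?pw.
have q4 : (a * s) ^+ 2 * a * (t ^+ 2 * 1) <= n ^+ 2 * n * (m ^+ 2 * m).
  by rewrite !pr ?mulr_ge0 ?ge0 ?pw.
have q5 : (a * s) ^+ 3 * 1 <= n ^+ 3 * m ^+ 3.
  by rewrite !pr ?mulr_ge0 ?ge0 ?pw.
have q6 : a ^+ 3 * t ^+ 3 <= n ^+ 3 * m ^+ 3.
  by rewrite !pr ?mulr_ge0 ?ge0 ?pw.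
have q7 : (b * t) ^+ 2 * b * (s ^+ 2 * 1) <= n ^+ 2 * n * (m ^+ 2 * m).
  by rewrite !pr ?mulr_ge0 ?ge0 ?pw.
have q8 : b ^+ 3 * s ^+ 3 <= n ^+ 3 * m ^+ 3.
  by rewrite !pr ?mulr_ge0 ?ge0 ?pw.
have q9 : (b * t) ^+ 3 * 1 <= n ^+ 3 * m ^+ 3.
  by rewrite !pr ?mulr_ge0 ?ge0 ?pw.
by lra.
Qed.

(** * Pairs at two prescribed distances *)

Section TwoDistances.
Variables (R : realType) (T : finType) (f g : T -> R * R) (M : nat) (d1 d2 : R).
Hypothesis fg_inj : forall s t, f s = f t -> g s = g t -> s = t.
Hypothesis fibre_le : forall t, (#|[set s | f s == f t]| <= M)%N.
Hypothesis d1_gt0 : 0 < d1.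
Hypothesis d2_gt0 : 0 < d2.

Definition two_distances := [set pq : T * T |
  (sqdist (f pq.1) (f pq.2) == d1) && (sqdist (g pq.1) (g pq.2) == d2)].

(** The factor 64 comes from two planar bounds with constant 8. The factor 384 is [6 * 2 ^ 6], from
    [dyadic_product_le] at twice the cube roots of [#|T|] and [M]. *)
Lemma two_distances_level_le i j :
  #|[set pq in two_distances | (level f (rep f pq.1) == i) &&
      (level f (rep f pq.2) == j)]|%:R <=
  64 * 384 * (cbrt R #|T| ^+ 4 * cbrt R M + #|T|%:R * M%:R).
Proof.
set S := [set pq in _ | _].
set A := reps_at f i; set B := reps_at f j.
have [S0|/set0Pn[[p0 q0]]] := eqVneq S set0.
  by rewrite S0 cards0 !(addr_ge0, mulr_ge0, exprn_ge0, cbrt_ge0).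
rewrite inE /= => /and3P[_ li lj].
have hA : A != set0 by apply/set0Pn; exists (rep f p0); rewrite inE rep_reps.
have hB : B != set0 by apply/set0Pn; exists (rep f q0); rewrite inE rep_reps.
have [s1 sm sn] := reps_at_cbrt fibre_le hA.
have [t1 tm tn] := reps_at_cbrt fibre_le hB.
have mono (X : {set T}) k : (#|X| <= k)%N -> 0 <= cbrt R #|X| <= cbrt R k.
  by move=> h; rewrite cbrt_ge0 ler_cbrt.
set s := cbrt R (2 ^ i.+1) in s1 sm sn; set t := cbrt R (2 ^ j.+1) in t1 tm tn.
set K := 8 * (s ^+ 2 * t ^+ 2 + s ^+ 3 + t ^+ 3).
pose O := [set ab | [&& ab.1 \in A, ab.2 \in B & sqdist (f ab.1) (f ab.2) == d1]].
have inA (X : {set T}) : X \subset reps f -> {in X &, injective f}.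
  by move=> /subsetP sX a b /sX ha /sX hb; apply: f_inj_reps.
have subA k : reps_at f k \subset reps f.
  by apply/subsetP => a; rewrite inE => /andP[].
have cO := unit_distances_set_le d1_gt0 (inA _ (subA i)) (inA _ (subA j)).
(* Send a pair of points to its pair of fibres, which lies in [O]; over each element of [O] the
   planar bound for [g] leaves at most [K] pairs. *)
have SO : #|S|%:R <= \sum_(ab in O) K.
  apply: (@card_le_sum_fibres _ _ _ _ _ (fun pq => (rep f pq.1, rep f pq.2))).
    move=> [p q]; rewrite !inE /= !f_rep => /andP[/andP[-> _] /andP[-> ->]].
    by rewrite !(eq_rep (f_rep f _)) !eqxx.
  move=> [a b]; rewrite inE /= => /and3P[aA bB _].
  have inF := g_inj_fibre fg_inj.
  have H := unit_distances_set_le d2_gt0 (@inF a) (@inF b).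
  apply: (le_trans _ (le_trans H _)).
    rewrite ler_nat; apply/subset_leq_card/subsetP => -[p q]; rewrite !inE /=.
    by case/andP=> /andP[/andP[_ ->] _]; rewrite -pair_eqE => /andP[-> ->].
  have /andP[x0 xs] : 0 <= cbrt R #|fibre f a| <= s.
    by apply: mono; case/andP: (reps_atP aA) => _ /ltnW.
  have /andP[z0 zt] : 0 <= cbrt R #|fibre f b| <= t.
    by apply: mono; case/andP: (reps_atP bB) => _ /ltnW.
  have pw (y y' : R) k : 0 <= y -> y <= y' -> y ^+ k <= y' ^+ k.
    by move=> y0 yy'; rewrite lerXn2r ?nnegrE // (le_trans y0).
  rewrite /K ler_wpM2l //.
  by rewrite !(lerD, pw, ler_pM, exprn_ge0).
rewrite sumr_const -(mulr_natl K) in SO.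
apply: le_trans SO _.
have K0 : 0 <= K.
  by rewrite /K mulr_ge0 // !addr_ge0 ?mulr_ge0 ?exprn_ge0 //; lra.
apply: le_trans (ler_wpM2r K0 cO) _.
have := dyadic_product_le (cbrt_ge0 R #|A|) (cbrt_ge0 R #|B|) s1 t1 sm tm sn tn.
rewrite /K -(cbrtK R #|T|) -(cbrtK R M) -/A -/B.
have : 0 <= cbrt R #|T| ^+ 4 * cbrt R M by rewrite mulr_ge0 ?exprn_ge0 ?cbrt_ge0.
have : 0 <= cbrt R #|T| ^+ 3 * cbrt R M ^+ 3.
  by rewrite mulr_ge0 ?exprn_ge0 ?cbrt_ge0.
move: (cbrt R #|T|) (cbrt R M) (cbrt R #|A|) (cbrt R #|B|) => n m a b.
lra.
Qed.

Lemma two_distances_le :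
  #|two_distances|%:R <= (trunc_log 2 #|T|).+1%:R ^+ 2 *
    (64 * 384 * (cbrt R #|T| ^+ 4 * cbrt R M + #|T|%:R * M%:R)).
Proof.
set L := (trunc_log 2 #|T|).+1; set K := 64 * 384 * _.
have levL p : (level f (rep f p) < L)%N by rewrite ltnS leq_trunc_log // max_card.
pose lv p : 'I_L := Ordinal (levL p).
have -> : L%:R ^+ 2 * K = \sum_(ij in [set: 'I_L * 'I_L]) K.
  by rewrite sumr_const cardsT card_prod card_ord -(mulr_natl K) natrM expr2.
apply: (@card_le_sum_fibres _ _ _ _ _ (fun pq => (lv pq.1, lv pq.2))) => //.
move=> [i j] _; apply: le_trans (two_distances_level_le i j).
rewrite ler_nat; apply/subset_leq_card/subsetP => -[p q]; rewrite inE.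
case/andP=> pq; rewrite xpair_eqE -!val_eqE /= => h.
by move: pq; rewrite !in_set => ->.
Qed.

End TwoDistances.

(** * From finite sets to finite types *)

Section FsetCounts.
Local Open Scope fset_scope.

Lemma card_pairs_le (K : choiceType) (P : {fset K}) (D : rel K) :
  (#|` [fset u in P `*` P | D u.1 u.2]| <= #|[set pq : P * P | D (val pq.1) (val pq.2)]|)%N.
Proof.
set S := [set pq | _]; set X := [fset u in _ | _].
have sub : X `<=` [fset (val pq.1, val pq.2) | pq in S].
  apply/fsubsetP => -[p q]; rewrite !inE /= => /andP[/andP[pP qP] Dpq].
  by apply/imfsetP; exists ([` pP], [` qP]); rewrite //= inE.
apply: leq_trans (fsubset_leq_card sub) _.
by rewrite (leq_trans (leq_imfset_card _ _ _)) // cardE.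
Qed.

Lemma card_fibre_multiplicity (K : choiceType) (T : eqType) (f : K -> T) (P : {fset K}) (p : P) :
  (#|[set q : P | f (val q) == f (val p)]| <= multiplicity f P)%N.
Proof.
apply: leq_trans (leq_bigmax_seq _ (valP p) isT).
set S := [set q | _].
apply: leq_trans (_ : #|` [fset val q | q in S]| <= _)%N.
  by rewrite card_imfset //=; [rewrite cardE | exact: val_inj].
apply: fsubset_leq_card; apply/fsubsetP => q /imfsetP[r /=].
by rewrite !inE => rP ->; rewrite (valP r).
Qed.
End FsetCounts.

(** * Counting in the double plane with real exponents *)

Section DoublePlaneCounts.
Variable R : realType.
Implicit Types (P : {fset double_number R * double_number R}) (d : double_number R).

Lemma parts_inj (p q : double_number R * double_number R) :
  real_part p = real_part q -> imag_part p = imag_part q -> p = q.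
Proof.
case: p q => [[a b] [c e]] [[a' b'] [c' e']]; rewrite /real_part /imag_part /dnx /dny /=.
case=> h1 h2 [h3 h4].
by congr (DoubleNumber _ _, DoubleNumber _ _); lra.
Qed.

Lemma rho_eqE (p q : double_number R * double_number R) d :
  (rho p q == d) = (sqdist (real_part p) (real_part q) == dnx d) &&
                   (sqdist (imag_part p) (imag_part q) == dny d).
Proof.
apply/eqP/andP => [<-|[/eqP h1 /eqP h2]].
  by rewrite dnx_rho dny_rho /sqdist.
rewrite -[sqdist _ _](dnx_rho p q) in h1; rewrite -[sqdist _ _](dny_rho p q) in h2.
case: (rho p q) d h1 h2 => [a b] [a' b']; rewrite /dnx /dny /= => h1 h2.
by congr DoubleNumber; lra.
Qed.

Lemma sqdist_eq0 (p q : R * R) : (sqdist p q == 0) = (p == q).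
Proof.
rewrite /sqdist paddr_eq0 ?sqr_ge0 // !sqrf_eq0 !subr_eq0.
by rewrite [p]surjective_pairing [q]surjective_pairing.
Qed.

(** For [n >= 2] both [ln 2] and [trunc_log 2 n] times [ln 2] are at most [ln n], whence the factor
    2. *)
Lemma log_level_le (n : nat) : (1 < n)%N ->
  (trunc_log 2 n).+1%:R ^+ 2 <= (2 / ln 2) ^+ 2 * ln n%:R ^+ 2 :> R.
Proof.
move=> n1; have l2 : 0 < ln 2 :> R by rewrite ln_gt0 // ltr1n.
have n0 : (0 < n)%N by exact: ltnW.
have hk : (trunc_log 2 n)%:R * ln 2 <= ln n%:R :> R.
  rewrite mulr_natl -lnXn // ler_ln ?posrE ?exprn_gt0 ?ltr0n //.
  by rewrite -natrX ler_nat trunc_logP.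
have hn : ln 2 <= ln n%:R :> R by rewrite ler_ln ?posrE ?ltr0n // ler_nat.
rewrite -exprMn lerXn2r ?nnegrE //.
  by rewrite mulr_ge0 ?divr_ge0 // ltW // (lt_le_trans l2).
rewrite mulrAC ler_pdivlMr // -natr1; lra.
Qed.

Lemma cbrt_powR (n k : nat) (lambda : R) : (0 < n)%N -> k%:R = n%:R `^ lambda :> R ->
  cbrt R n ^+ 4 * cbrt R k = n%:R `^ (4 / 3 + lambda / 3) /\
  n%:R * cbrt R k = n%:R `^ (1 + lambda / 3).
Proof.
move=> n0 kn; have nn : n%:R != 0 :> R by rewrite pnatr_eq0 -lt0n.
rewrite !powRD ?nn ?implybT // powRr1 // /cbrt kn -powRrM.
by rewrite -powR_mulrn ?powR_ge0 // -powRrM [3^-1 * 4]mulrC.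
Qed.

Lemma two_distances_bound P (f g : double_number R * double_number R -> R * R)
    (d1 d2 lambda : R) : 0 < d1 -> 0 < d2 ->
  (forall p q, f p = f q -> g p = g q -> p = q) ->
  (multiplicity f P)%:R = #|` P|%fset%:R `^ lambda :> R ->
  #|` [fset u in (P `*` P) | (sqdist (f u.1) (f u.2) == d1) &&
     (sqdist (g u.1) (g u.2) == d2)]|%fset%:R <=
  ((2 / ln 2) ^+ 2 * (64 * 384)) *
   (#|` P|%fset%:R `^ (4 / 3 + lambda / 3) + #|` P|%fset%:R `^ (1 + lambda))
                * ln #|` P|%fset%:R ^+ 2.
Proof.
move=> d10 d20 inj mult.
have := @card_pairs_le _ P (fun p q => (sqdist (f p) (f q) == d1) &&
  (sqdist (g p) (g q) == d2)).
rewrite -(ler_nat R) => /le_trans; apply.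
have inj' (s t : P) : f (val s) = f (val t) -> g (val s) = g (val t) -> s = t.
  by move=> h1 h2; apply/val_inj/inj.
have fib (t : P) : (#|[set s : P | f (val s) == f (val t)]| <= multiplicity f P)%N.
  exact: card_fibre_multiplicity.
have bound := two_distances_le inj' fib d10 d20.
set S := [set pq | _]; rewrite -[S]/(two_distances (f \o val) (g \o val) d1 d2).
rewrite -cardfE in bound; set n := #|` P|%fset in mult bound *.
(* Here the logarithm vanishes, so the count must be 0: a lone point is not at positive distance
   from itself. *)
have [n1|n1] := leqP n 1.
  suff -> : two_distances (f \o val) (g \o val) d1 d2 = set0 :> {set P * P}.
    rewrite cards0; apply: mulr_ge0; last exact: sqr_ge0.
    by rewrite mulr_ge0 ?addr_ge0 ?powR_ge0 //; apply: mulr_ge0; rewrite ?sqr_ge0 // mulr_ge0.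
  apply/setP => -[p q]; rewrite !inE /=.
  have -> : p = q by move: n1; rewrite /n cardfE => /fintype_le1P/(_ q)->.
  by rewrite /sqdist !subrr expr0n addr0 eq_sym gt_eqF.
have n0 : (0 < n)%N by exact: ltnW.
have [E _] := cbrt_powR n0 mult.
have nn : n%:R != 0 :> R by rewrite pnatr_eq0 -lt0n.
apply: le_trans bound _; rewrite E mult.
have -> : n%:R * n%:R `^ lambda = n%:R `^ (1 + lambda) :> R.
  by rewrite powRD ?nn ?implybT // powRr1.
set X := _ + _; have X0 : 0 <= X by rewrite addr_ge0 ?powR_ge0.
have KX0 : 0 <= 64 * 384 * X by rewrite !mulr_ge0.
apply: le_trans (ler_wpM2r KX0 (log_level_le n1)) _.
by rewrite le_eqVlt; apply/orP; left; apply/eqP; ring.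
Qed.

Lemma same_part_bound P (f g : double_number R * double_number R -> R * R)
    (d lambda : R) : 0 < d ->
  (forall p q, f p = f q -> g p = g q -> p = q) ->
  (multiplicity f P)%:R = #|` P|%fset%:R `^ lambda :> R -> P != fset0 ->
  #|` [fset u in (P `*` P) | (f u.1 == f u.2) &&
     (sqdist (g u.1) (g u.2) == d)]|%fset%:R <=
  24 * #|` P|%fset%:R `^ (1 + lambda / 3).
Proof.
move=> d0 inj mult P0.
have n0 : (0 < #|` P|%fset)%N by rewrite cardfs_gt0.
have [_ <-] := cbrt_powR n0 mult.
have := @card_pairs_le _ P (fun p q => (f p == f q) && (sqdist (g p) (g q) == d)).
rewrite -(ler_nat R) => /le_trans; apply.
have inj' (s t : P) : f (val s) = f (val t) -> g (val s) = g (val t) -> s = t.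
  by move=> h1 h2; apply/val_inj/inj.
have fib (t : P) : (#|[set s : P | f (val s) == f (val t)]| <= multiplicity f P)%N.
  exact: card_fibre_multiplicity.
by have := same_fibre_le inj' fib d0; rewrite -cardfE -mulrA.
Qed.

End DoublePlaneCounts.


Theorem theorem1p3 (R : realType) :
  exists C : R,
    forall (n : nat) (P : {fset double_number R * double_number R})
      (d : double_number R) (lambda : R),
      #|` P|%fset = n -> P != fset0 ->
      is_distance d -> d != 0 ->
      0 <= lambda <= 1 ->
      [/\ typeA d -> (min_multiplicity P)%:R = n%:R `^ lambda ->
            (nb_spanned d P)%:R <=
              C * (n%:R `^ (4 / 3 + lambda / 3) + n%:R `^ (1 + lambda))
                * ln n%:R ^+ 2,
          typeB d -> (real_multiplicity P)%:R = n%:R `^ lambda ->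
            (nb_spanned d P)%:R <= C * n%:R `^ (1 + lambda / 3)
        & typeC d -> (imag_multiplicity P)%:R = n%:R `^ lambda ->
            (nb_spanned d P)%:R <= C * n%:R `^ (1 + lambda / 3)].
Proof.
set K := ((2 / ln 2) ^+ 2 * (64 * 384) : R).
have K0 : 0 <= K by apply: mulr_ge0; rewrite ?sqr_ge0 // mulr_ge0.
exists (K + 24) => n P d lambda cardP P0 dist_d d0 lambda01.
have inj := @parts_inj R.
have inj' (p q : double_number R * double_number R) :
    imag_part p = imag_part q -> real_part p = real_part q -> p = q.
  by move=> h1 h2; apply: inj.
have nbE : nb_spanned d P = #|` [fset u in P `*` P |
    (sqdist (real_part u.1) (real_part u.2) == dnx d) &&
    (sqdist (imag_part u.1) (imag_part u.2) == dny d)]|%fset.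
  by congr #|` _|%fset; apply/fsetP => u; rewrite !inE rho_eqE.
have nbE' : nb_spanned d P = #|` [fset u in P `*` P |
    (sqdist (imag_part u.1) (imag_part u.2) == dny d) &&
    (sqdist (real_part u.1) (real_part u.2) == dnx d)]|%fset.
  by rewrite nbE; congr #|` _|%fset; apply/fsetP => u; rewrite !inE; congr andb; exact: andbC.
split.
- case/andP=> x0 y0 mult.
  apply: (@le_trans _ _ (K * (n%:R `^ (4 / 3 + lambda / 3) + n%:R `^ (1 + lambda)) * ln n%:R ^+ 2)).
    rewrite -cardP in mult *; move: mult; rewrite /min_multiplicity.
    (* The part attaining the minimum plays the role of [f]. *)
    case: leqP => _ mult; first by rewrite nbE two_distances_bound.
    by rewrite nbE' two_distances_bound.
  by rewrite ler_wpM2r ?sqr_ge0 // ler_wpM2r ?addr_ge0 ?powR_ge0 // lerDl.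
- case/andP=> /eqP x0 y0 mult.
  apply: (@le_trans _ _ (24 * n%:R `^ (1 + lambda / 3))).
    (* A zero first distance means equal real parts, by [sqdist_eq0]. *)
    rewrite -cardP in mult *; rewrite nbE x0.
    have := same_part_bound y0 inj mult P0.
    by congr (_%:R <= _); congr #|` _|%fset; apply/fsetP => u; rewrite !inE sqdist_eq0.
  by rewrite ler_wpM2r ?powR_ge0 // lerDr.
case/andP=> x0 /eqP y0 mult.
apply: (@le_trans _ _ (24 * n%:R `^ (1 + lambda / 3))).
  rewrite -cardP in mult *; rewrite nbE' y0.
  have := same_part_bound x0 inj' mult P0.
  by congr (_%:R <= _); congr #|` _|%fset; apply/fsetP => u; rewrite !inE sqdist_eq0.
by rewrite ler_wpM2r ?powR_ge0 // lerDr.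
Qed.
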